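(* Let $k$ be an algebraically closed field of characteristic zero, let $H$ be a Hopf algebra over $k$, and let $A, L \subseteq H$ be Hopf subalgebras such that $(A,L)$ is a factorization of $H$. Suppose that $A$ is a normal Hopf subalgebra of $H$. Then $A\#L \cong H$ as Hopf algebras via the multiplication map $\phi: A\# L \to H$, $a \# l \mapsto al$.
   Context: Sweedler notation $\Delta(h)=h_1\otimes h_2$ is used; $S$ is the antipode and $\epsilon$ the counit. A Hopf subalgebra $A\subseteq H$ is normal if $h_1 A S(h_2)\subseteq A$ and $S(h_1)Ah_2\subseteq A$ for all $h\in H$. For Hopf subalgebras $A,L$ of $H$, $(A,L)$ is a factorization of $H$ if the multiplication map $A\otimes L\to H$, $a\otimes l\mapsto al$, is bijective (equivalently, $H$ is a bicrossed product of $A$ and $L$ via multiplication). When $A$ is normal, $L$ acts on $A$ by the adjoint action $l.a = l_1 a S(l_2)$, and $A\#L$ denotes the vector space $A\otimes L$ (with $a\otimes l$ written $a\# l$) with the smash product multiplication $(a\#l)(a'\#l') = a(l_1.a')\# l_2 l'$, unit $1\#1$, and the tensor product coalgebra structure; the claim includes that this is a Hopf algebra. *)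

(* Defs.v *)
From HB Require Import structures.
From mathcomp Require Import all_boot all_algebra.
From mathcomp Require Import boolp.

Set Implicit Arguments.
Unset Strict Implicit.
Unset Printing Implicit Defensive.

Import GRing.Theory.

Local Open Scope ring_scope.
Local Open Scope quotient_scope.

Declare Scope tensor_scope.

Reserved Notation "v ⊗ w" (at level 45, no associativity).
Reserved Notation "\tsum_ ( x ⊗ y <- t ) E"
  (at level 41, E at level 41, x name, y name,
   format "'[' \tsum_ ( x ⊗ y <- t ) '/  '  E ']'").

(* A finite formal sum of pairs [:: (v_1, w_1); ...; (v_n, w_n)] stands for *)
(* v_1 ⊗ w_1 + ... + v_n ⊗ w_n.  Two formal sums are identified when no     *)
(* bilinear map separates them, so the quotient has the universal property  *)
(* of the tensor product: see tliftE, tlift_linear and tlift_unique.        *)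

Section Tensor.
Variables (k : fieldType) (V W : lmodType k).

Definition feval (U : lmodType k) (f : V -> W -> U) (s : seq (V * W)) : U :=
  \sum_(p <- s) f p.1 p.2.

Definition tens_rel : rel (seq (V * W)) := fun s t =>
  `[< forall (U : lmodType k) (f : V -> W -> U),
        bilinear_for *:%R *:%R f -> feval f s = feval f t >].

Lemma tens_rel_equiv : equiv_class_of tens_rel.
Proof.
split=> [s|s t|t s u].
- exact/asboolP.
- by apply/asboolP/asboolP => H U f /H.
- move=> /asboolP H1 /asboolP H2; apply/asboolP => U f bf.
  by rewrite H1 ?H2.
Qed.

Canonical tens_equiv := EquivRelPack tens_rel_equiv.

Definition tensor := {eq_quot tens_equiv}.

HB.instance Definition _ := EqQuotient.on tensor.
HB.instance Definition _ := Choice.on tensor.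

Lemma tensP (s t : seq (V * W)) :
  \pi_tensor s = \pi_tensor t <->
  forall (U : lmodType k) (f : V -> W -> U),
    bilinear_for *:%R *:%R f -> feval f s = feval f t.
Proof.
split=> [/eqmodP/asboolP //|H]; apply/eqmodP; exact/asboolP.
Qed.

Lemma feval_repr (U : lmodType k) (f : V -> W -> U) (s : seq (V * W)) :
  bilinear_for *:%R *:%R f -> feval f (repr (\pi_tensor s)) = feval f s.
Proof. by move=> bf; apply: (tensP _ _).1 bf; rewrite reprK. Qed.

Definition fscale (c : k) (s : seq (V * W)) := [seq (c *: p.1, p.2) | p <- s].

Definition tens_zero : tensor := \pi_tensor [::].
Definition tens_add (x y : tensor) : tensor := \pi_tensor (repr x ++ repr y).
Definition tens_scale (c : k) (x : tensor) : tensor :=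
  \pi_tensor (fscale c (repr x)).
Definition tens_opp (x : tensor) : tensor := tens_scale (-1) x.

Lemma feval_cat (U : lmodType k) (f : V -> W -> U) s t :
  feval f (s ++ t) = feval f s + feval f t.
Proof. exact: big_cat. Qed.

Lemma feval_scale (U : lmodType k) (f : V -> W -> U) c s :
  bilinear_for *:%R *:%R f -> feval f (fscale c s) = c *: feval f s.
Proof.
move=> [fl _]; rewrite /feval big_map scaler_sumr; apply: eq_bigr => p _ /=.
exact: (scalable_linear (fl p.2)).
Qed.

Lemma tens_eqP (x y : tensor) :
  (forall (U : lmodType k) (f : V -> W -> U), bilinear_for *:%R *:%R f ->
     feval f (repr x) = feval f (repr y)) -> x = y.
Proof. by move=> H; rewrite -[x]reprK -[y]reprK; apply/tensP. Qed.

Let simpl_feval (U : lmodType k) (f : V -> W -> U)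
    (bf : bilinear_for *:%R *:%R f) :=
  (fun s => feval_repr s bf, feval_cat f, fun c s => feval_scale c s bf).

Lemma tens_addA : associative tens_add.
Proof.
by move=> x y z; apply: tens_eqP => U f bf; rewrite !(simpl_feval bf) addrA.
Qed.

Lemma tens_addC : commutative tens_add.
Proof.
by move=> x y; apply: tens_eqP => U f bf; rewrite !(simpl_feval bf) addrC.
Qed.

Lemma tens_add0 : left_id tens_zero tens_add.
Proof.
move=> x; apply: tens_eqP => U f bf; rewrite !(simpl_feval bf).
by rewrite /feval big_nil add0r.
Qed.

Lemma tens_addN : left_inverse tens_zero tens_opp tens_add.
Proof.
move=> x; apply: tens_eqP => U f bf; rewrite !(simpl_feval bf).
by rewrite scaleN1r addNr /feval big_nil.
Qed.

HB.instance Definition _ :=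
  GRing.isZmodule.Build tensor tens_addA tens_addC tens_add0 tens_addN.

Lemma tens_scaleA (a b : k) x :
  tens_scale a (tens_scale b x) = tens_scale (a * b) x.
Proof.
by apply: tens_eqP => U f bf; rewrite !(simpl_feval bf) scalerA.
Qed.

Lemma tens_scale1 : left_id 1 tens_scale.
Proof.
by move=> x; apply: tens_eqP => U f bf; rewrite !(simpl_feval bf) scale1r.
Qed.

Lemma tens_scaleDr : right_distributive tens_scale +%R.
Proof.
by move=> c x y; apply: tens_eqP => U f bf; rewrite !(simpl_feval bf) scalerDr.
Qed.

Lemma tens_scaleDl x : {morph tens_scale^~ x : a b / a + b}.
Proof.
by move=> a b; apply: tens_eqP => U f bf; rewrite !(simpl_feval bf) scalerDl.
Qed.

HB.instance Definition _ := GRing.Zmodule_isLmodule.Build k tensor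
  tens_scaleA tens_scale1 tens_scaleDr tens_scaleDl.

Definition tens (v : V) (w : W) : tensor := \pi_tensor [:: (v, w)].

(* The value at t of the linear map induced by f.  It is defined for every  *)
(* function f, but is meaningful only for bilinear f; see tliftE.           *)
Definition tlift (U : lmodType k) (f : V -> W -> U) (t : tensor) : U :=
  feval f (repr t).

Lemma tliftE (U : lmodType k) (f : V -> W -> U) v w :
  bilinear_for *:%R *:%R f -> tlift f (tens v w) = f v w.
Proof. by move=> bf; rewrite /tlift feval_repr // /feval big_seq1. Qed.

Lemma tlift_linear (U : lmodType k) (f : V -> W -> U) :
  bilinear_for *:%R *:%R f -> linear (tlift f).
Proof. by move=> bf c x y; rewrite /tlift !(simpl_feval bf). Qed.

Lemma tens_bilinear : bilinear_for *:%R *:%R tens.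
Proof.
split=> [w c v v'|v c w w']; apply: tens_eqP => U f bf;
  rewrite !(simpl_feval bf) /feval !big_seq1 /=.
- exact: bf.1.
- exact: bf.2.
Qed.

Lemma tens_sum (t : tensor) : t = \sum_(p <- repr t) tens p.1 p.2.
Proof.
rewrite -[LHS]reprK; elim: (repr t) => [|p s IH]; first by rewrite big_nil.
rewrite big_cons -IH; apply: tens_eqP => U f bf.
by rewrite !(simpl_feval bf) /feval big_cons big_seq1.
Qed.

Lemma tlift_unique (U : lmodType k) (f : V -> W -> U) (g : tensor -> U) :
  linear g -> (forall v w, g (tens v w) = f v w) -> g =1 tlift f.
Proof.
move=> lg gE t; rewrite {1}[t]tens_sum /tlift /feval.
pose G : {linear tensor -> U} :=
  HB.pack g (GRing.isLinear.Build k tensor U *:%R g lg).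
by rewrite -[g]/(G : _ -> _) linear_sum; apply: eq_bigr => p _; apply: gE.
Qed.

End Tensor.

Arguments tens {k V W}.

Notation "v ⊗ w" := (tens v w) : tensor_scope.

(* Sweedler notation: for E bilinear in x, y and t = x_1 ⊗ y_1 + ..., this  *)
(* is E(x_1, y_1) + ....                                                    *)
Notation "\tsum_ ( x ⊗ y <- t ) E" :=
  (tlift (fun x y => E) t) : tensor_scope.

Local Open Scope tensor_scope.

Definition tens_map (k : fieldType) (V W V' W' : lmodType k)
    (f : V -> V') (g : W -> W') (t : tensor V W) : tensor V' W' :=
  \tsum_(v ⊗ w <- t) (f v ⊗ g w).

Record hopf_data (k : fieldType) (V : lmodType k) := HopfData {
  hmul : V -> V -> V;
  hone : V;
  hcomul : V -> tensor V V;
  hcounit : V -> k;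
  hantipode : V -> V
}.

Record is_algebra (k : fieldType) (V : lmodType k) (D : hopf_data V) : Prop :=
IsAlgebra {
  hmul_bilinear : bilinear_for *:%R *:%R (hmul D);
  hmulA : associative (hmul D);
  hmul1l : left_id (hone D) (hmul D);
  hmul1r : right_id (hone D) (hmul D)
}.

Record is_coalgebra (k : fieldType) (V : lmodType k) (D : hopf_data V) : Prop :=
IsCoalgebra {
  hcomul_linear : linear (hcomul D);
  hcounit_linear : scalar (hcounit D);
  hcomulA : forall h,
    \tsum_(h1 ⊗ h2 <- hcomul D h)
      \tsum_(h11 ⊗ h12 <- hcomul D h1) (h11 ⊗ (h12 ⊗ h2)) =
    \tsum_(h1 ⊗ h2 <- hcomul D h)
      \tsum_(h21 ⊗ h22 <- hcomul D h2) (h1 ⊗ (h21 ⊗ h22));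
  hcounitl : forall h,
    \tsum_(h1 ⊗ h2 <- hcomul D h) (hcounit D h1 *: h2) = h;
  hcounitr : forall h,
    \tsum_(h1 ⊗ h2 <- hcomul D h) (hcounit D h2 *: h1) = h
}.

Record is_hopf_algebra (k : fieldType) (V : lmodType k) (D : hopf_data V) :
  Prop :=
IsHopfAlgebra {
  hopf_algebraP : is_algebra D;
  hopf_coalgebraP : is_coalgebra D;
  hcomul1 : hcomul D (hone D) = hone D ⊗ hone D;
  hcomulM : forall g h,
    hcomul D (hmul D g h) =
    \tsum_(g1 ⊗ g2 <- hcomul D g)
      \tsum_(h1 ⊗ h2 <- hcomul D h) (hmul D g1 h1 ⊗ hmul D g2 h2);
  hcounit1 : hcounit D (hone D) = 1;
  hcounitM : {morph hcounit D : g h / hmul D g h >-> g * h};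
  hantipode_linear : linear (hantipode D);
  hantipodel : forall h,
    \tsum_(h1 ⊗ h2 <- hcomul D h) hmul D (hantipode D h1) h2 =
    hcounit D h *: hone D;
  hantipoder : forall h,
    \tsum_(h1 ⊗ h2 <- hcomul D h) hmul D h1 (hantipode D h2) =
    hcounit D h *: hone D
}.

Record is_hopf_morphism (k : fieldType) (V W : lmodType k)
  (D : hopf_data V) (E : hopf_data W) (f : V -> W) : Prop :=
IsHopfMorphism {
  hmorph_linear : linear f;
  hmorph_mul : {morph f : x y / hmul D x y >-> hmul E x y};
  hmorph_one : f (hone D) = hone E;
  hmorph_comul : forall x, hcomul E (f x) = tens_map f f (hcomul D x);
  hmorph_counit : forall x, hcounit E (f x) = hcounit D x;
  hmorph_antipode : {morph f : x / hantipode D x >-> hantipode E x}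
}.

Definition is_hopf_isomorphism (k : fieldType) (V W : lmodType k)
    (D : hopf_data V) (E : hopf_data W) (f : V -> W) : Prop :=
  is_hopf_morphism D E f /\ bijective f.

HB.mixin Record Algebra_isHopf (k : fieldType) H of GRing.Algebra k H := {
  comul : H -> tensor H H;
  counit : H -> k;
  antipode : H -> H;
  hopf_subproof :
    is_hopf_algebra (HopfData *%R (1 : H) comul counit antipode)
}.

#[short(type="hopfAlgType")]
HB.structure Definition HopfAlgebra (k : fieldType) :=
  {H of Algebra_isHopf k H & GRing.Algebra k H}.

Definition hopf_data_of (k : fieldType) (H : hopfAlgType k) : hopf_data H :=
  HopfData *%R (1 : H) comul counit antipode.

Lemma hopf_data_ofP (k : fieldType) (H : hopfAlgType k) :
  is_hopf_algebra (hopf_data_of H).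
Proof. exact: hopf_subproof. Qed.

Section Subalgebra.
Variables (k : fieldType) (H : algType k) (A : subalgClosed H).

Definition subalg_of := {x : H | x \in A}.

HB.instance Definition _ := SubChoice.on subalg_of.
HB.instance Definition _ := [SubChoice_isSubAlgebra of subalg_of by <:].

End Subalgebra.

Section HopfSubalgebra.
Variables (k : fieldType) (H : hopfAlgType k).

(* The first condition says that comul A lies in the image of A ⊗ A. *)
Record is_hopf_subalgebra (A : subalgClosed H) : Prop := IsHopfSubalgebra {
  comul_closed : forall a : subalg_of A,
    exists t : tensor (subalg_of A) (subalg_of A),
      tens_map val val t = comul (val a);
  antipode_closed : forall a, a \in A -> antipode a \in A
}.

Definition is_normal (A : subalgClosed H) : Prop :=
  forall h a, a \in A ->
    \tsum_(h1 ⊗ h2 <- comul h) (h1 * a * antipode h2) \in A /\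
    \tsum_(h1 ⊗ h2 <- comul h) (antipode h1 * a * h2) \in A.

(* The restriction of comul to A, valued in A ⊗ A.  As A ⊗ A -> H ⊗ H is    *)
(* injective (k is a field), the preimage chosen here is the only one.      *)
Definition sub_comul (A : subalgClosed H) (hA : is_hopf_subalgebra A)
    (a : subalg_of A) : tensor (subalg_of A) (subalg_of A) :=
  sval (cid (comul_closed hA a)).

Definition mul_map (A L : subalgClosed H)
    (t : tensor (subalg_of A) (subalg_of L)) : H :=
  \tsum_(a ⊗ l <- t) (val a * val l).

Definition is_factorization (A L : subalgClosed H) : Prop :=
  bijective (@mul_map A L).

End HopfSubalgebra.

Arguments mul_map {k H} A L t.

Section Smash.
Variables (k : fieldType) (H : hopfAlgType k) (A L : subalgClosed H).
Hypotheses (hA : is_hopf_subalgebra A) (hL : is_hopf_subalgebra L).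
Hypothesis (nA : is_normal A).

Local Notation sA := (subalg_of A).
Local Notation sL := (subalg_of L).

Definition adjoint_action (l : sL) (a : sA) : sA :=
  Sub (\tsum_(l1 ⊗ l2 <- comul (val l)) (l1 * val a * antipode l2))
      (nA (val l) (valP a)).1.

Definition smash_mul (x y : tensor sA sL) : tensor sA sL :=
  \tsum_(a ⊗ l <- x) \tsum_(a' ⊗ l' <- y) \tsum_(l1 ⊗ l2 <- sub_comul hL l)
    ((a * adjoint_action l1 a') ⊗ (l2 * l')).

Definition smash_comul (x : tensor sA sL) :
    tensor (tensor sA sL) (tensor sA sL) :=
  \tsum_(a ⊗ l <- x) \tsum_(a1 ⊗ a2 <- sub_comul hA a)
    \tsum_(l1 ⊗ l2 <- sub_comul hL l) ((a1 ⊗ l1) ⊗ (a2 ⊗ l2)).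

Definition smash_counit (x : tensor sA sL) : k :=
  tlift (U := k^o) (fun a l => counit (val a) * counit (val l)) x.

(* The antipode S is not part of the construction of A # L; whether one     *)
(* exists is part of being a Hopf algebra.                                  *)
Definition smash_data (S : tensor sA sL -> tensor sA sL) :
    hopf_data (tensor sA sL) :=
  HopfData smash_mul (1 ⊗ 1) smash_comul smash_counit S.

End Smash.

(* Main.v *)
From HB Require Import structures.
Require Import Defs.
From mathcomp Require Import all_boot all_algebra.
From mathcomp Require Import boolp.
Import GRing.Theory.

Set Implicit Arguments.
Unset Strict Implicit.
Unset Printing Implicit Defensive.

Local Open Scope ring_scope.
Local Open Scope tensor_scope.

(** The map [phi : a ⊗ l |-> a l] is linear and bijective, so it is enough to
    check that it intertwines the operations of [A # L] with those of [H]: every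
    Hopf algebra axiom then transports back along [phi], the antipode of [A # L]
    being [phi^-1 \o S \o phi].  For the product this is the computation
    [l_1 a S(l_2) l_3 = l a], which turns [a (l_1 . a') l_2 l'] into [a l a' l'];
    for the coproduct it is the multiplicativity of the coproduct of [H]. *)

(** * Linear maps and pure tensors *)

Lemma linear_sum_fun (k : fieldType) (U U' : lmodType k) (g : U -> U') (I : Type)
    (s : seq I) (F : I -> U) :
  linear g -> g (\sum_(i <- s) F i) = \sum_(i <- s) g (F i).
Proof.
move=> lg.
pose G : {linear U -> U'} :=
  HB.pack g (GRing.isLinear.Build k U U' *:%R g lg).
exact: (linear_sum G).
Qed.

Lemma linearZ_fun (k : fieldType) (U U' : lmodType k) (g : U -> U') c x :
  linear g -> g (c *: x) = c *: g x.
Proof. by move=> lg; apply: (scalable_linear lg). Qed.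

Lemma tens_linearl (k : fieldType) (V W : lmodType k) c (v v' : V) (w : W) :
  (c *: v + v') ⊗ w = c *: (v ⊗ w) + v' ⊗ w.
Proof. exact: (tens_bilinear V W).1. Qed.

Lemma tens_linearr (k : fieldType) (V W : lmodType k) c (v : V) (w w' : W) :
  v ⊗ (c *: w + w') = c *: (v ⊗ w) + v ⊗ w'.
Proof. exact: (tens_bilinear V W).2. Qed.

Lemma tens3l_bilinear (k : fieldType) (U V W : lmodType k) (w : W) :
  bilinear_for *:%R *:%R (fun (u : U) (v : V) => u ⊗ (v ⊗ w)).
Proof.
split=> [v c x y|u c x y]; first by rewrite tens_linearl.
by rewrite tens_linearl tens_linearr.
Qed.

Lemma tens3r_bilinear (k : fieldType) (U V W : lmodType k) (u : U) :
  bilinear_for *:%R *:%R (fun (v : V) (w : W) => u ⊗ (v ⊗ w)).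
Proof.
split=> [w c x y|v c x y]; last by rewrite !tens_linearr.
by rewrite tens_linearl tens_linearr.
Qed.

(** * Induced maps on tensor products *)

Section TensorLift.
Variables (k : fieldType) (V W : lmodType k).

(* No bilinearity of [f] is required: [tlift f t] is a finite sum in any case. *)
Lemma linear_tlift (U U' : lmodType k) (g : U -> U') (f : V -> W -> U)
    (t : tensor V W) :
  linear g -> g (\tsum_(v ⊗ w <- t) f v w) = \tsum_(v ⊗ w <- t) g (f v w).
Proof. exact: linear_sum_fun. Qed.

Lemma eq_tlift (U : lmodType k) (f g : V -> W -> U) (t : tensor V W) :
  (forall v w, f v w = g v w) -> tlift f t = tlift g t.
Proof. by move=> fg; apply: eq_bigr => p _; apply: fg. Qed.

(** For nested Sweedler sums: with [t] fixed, the sum runs over one fixed representative, so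
    linearity in an outer variable is checked term by term. *)
Lemma tlift_param_linear (U Z : lmodType k) (f : Z -> V -> W -> U)
    (t : tensor V W) :
  (forall v w, linear (fun z => f z v w)) -> linear (fun z => tlift (f z) t).
Proof.
move=> lf c x y; rewrite /tlift /feval scaler_sumr -big_split /=.
by apply: eq_bigr => p _; apply: lf.
Qed.

(** The representative chosen for [tens_map f g t] need not be the image of the one chosen for [t];
    bilinearity of [F] makes the value independent of that choice. *)
Lemma tlift_tens_map (V' W' U : lmodType k) (F : V' -> W' -> U)
    (f : V -> V') (g : W -> W') (t : tensor V W) :
  bilinear_for *:%R *:%R F ->
  tlift F (tens_map f g t) = \tsum_(v ⊗ w <- t) F (f v) (g w).
Proof.
move=> bF; rewrite /tens_map (linear_tlift _ _ (tlift_linear bF)).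
by apply: eq_tlift => v w; apply: tliftE.
Qed.

Lemma tens_map_bilinear (V' W' : lmodType k) (f : V -> V') (g : W -> W') :
  linear f -> linear g ->
  bilinear_for *:%R *:%R (fun v w => f v ⊗ g w).
Proof.
move=> lf lg; split=> [w c x y|v c x y].
- by rewrite lf tens_linearl.
- by rewrite lg tens_linearr.
Qed.

Lemma tens_map_linear (V' W' : lmodType k) (f : V -> V') (g : W -> W') :
  linear f -> linear g -> linear (tens_map f g).
Proof. by move=> lf lg; apply/tlift_linear/tens_map_bilinear. Qed.

Lemma tens_mapE (V' W' : lmodType k) (f : V -> V') (g : W -> W') v w :
  linear f -> linear g -> tens_map f g (v ⊗ w) = f v ⊗ g w.
Proof. by move=> lf lg; rewrite /tens_map tliftE //; apply: tens_map_bilinear. Qed.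

End TensorLift.

Lemma tens_mapK (k : fieldType) (V W V' W' : lmodType k) (f : V -> V') (g : W -> W')
    (f' : V' -> V) (g' : W' -> W) :
  linear f' -> linear g' -> cancel f f' -> cancel g g' ->
  cancel (tens_map f g) (tens_map f' g').
Proof.
move=> lf lg fK gK t; rewrite {1}/tens_map tlift_tens_map; last first.
  exact: tens_map_bilinear.
by rewrite [RHS]tens_sum; apply: eq_bigr => p _; rewrite fK gK.
Qed.

Lemma can_linear (k : fieldType) (V W : lmodType k) (f : V -> W) (g : W -> V) :
  linear f -> cancel f g -> cancel g f -> linear g.
Proof. by move=> lf fK gK c x y; rewrite -{1}[x]gK -{1}[y]gK -lf fK. Qed.

(** * Bilinearity of the summands in the Hopf algebra axioms *)

Section HopfDataBilinear.
Variables (k : fieldType) (V : lmodType k) (D : hopf_data V).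
Hypothesis hD : is_hopf_algebra D.

Let mulL := (hmul_bilinear (hopf_algebraP hD)).1.
Let mulR := (hmul_bilinear (hopf_algebraP hD)).2.
Let comL := hcomul_linear (hopf_coalgebraP hD).
Let epsL := hcounit_linear (hopf_coalgebraP hD).
Let antL := hantipode_linear hD.

Lemma coassocl_bilinear :
  bilinear_for *:%R *:%R (fun (h1 h2 : V) =>
    \tsum_(h11 ⊗ h12 <- hcomul D h1) (h11 ⊗ (h12 ⊗ h2))).
Proof.
split=> [w c x y|v].
- by rewrite comL tlift_linear //; apply: tens3l_bilinear.
- apply: tlift_param_linear => v' w' d x y.
  by rewrite !tens_linearr.
Qed.

Lemma coassocr_bilinear :
  bilinear_for *:%R *:%R (fun (h1 h2 : V) =>
    \tsum_(h21 ⊗ h22 <- hcomul D h2) (h1 ⊗ (h21 ⊗ h22))).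
Proof.
split=> [w|v c x y].
- apply: tlift_param_linear => v' w' d x y.
  by rewrite tens_linearl.
- by rewrite comL tlift_linear //; apply: tens3r_bilinear.
Qed.

Lemma counitl_bilinear :
  bilinear_for *:%R *:%R (fun (h1 h2 : V) => hcounit D h1 *: h2).
Proof.
split=> [w c x y|v c x y].
- by rewrite /= epsL scalerDl scalerA.
- by rewrite /= scalerDr !scalerA mulrC.
Qed.

Lemma counitr_bilinear :
  bilinear_for *:%R *:%R (fun (h1 h2 : V) => hcounit D h2 *: h1).
Proof.
split=> [w c x y|v c x y].
- by rewrite /= scalerDr !scalerA mulrC.
- by rewrite /= epsL scalerDl scalerA.
Qed.

Lemma antipodel_bilinear :
  bilinear_for *:%R *:%R (fun (h1 h2 : V) => hmul D (hantipode D h1) h2).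
Proof.
split=> [w c x y|v c x y]; last exact: mulR.
by rewrite antL; apply: mulL.
Qed.

Lemma antipoder_bilinear :
  bilinear_for *:%R *:%R (fun (h1 h2 : V) => hmul D h1 (hantipode D h2)).
Proof.
split=> [w c x y|v c x y]; first exact: mulL.
by rewrite antL; apply: mulR.
Qed.

Lemma mul_tens_bilinear (x y : V) :
  bilinear_for *:%R *:%R (fun (h1 h2 : V) => hmul D x h1 ⊗ hmul D y h2).
Proof. apply: tens_map_bilinear => ?; exact: mulR. Qed.

(** Serves the outer of the two sums in the multiplicativity of the coproduct; [mul_tens_bilinear]
    serves the inner one. *)
Lemma tens_mul_bilinear (t : tensor V V) :
  bilinear_for *:%R *:%R (fun (g1 g2 : V) =>
    \tsum_(h1 ⊗ h2 <- t) (hmul D g1 h1 ⊗ hmul D g2 h2)).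
Proof.
split=> [w|v]; apply: tlift_param_linear => v' w' d x y.
- by rewrite (mulL v' d x y) tens_linearl.
- by rewrite (mulL w' d x y) tens_linearr.
Qed.

End HopfDataBilinear.

(** * Transport of the Hopf algebra axioms along a bijection *)

Section Transport.
Variables (k : fieldType) (V W : lmodType k).
Variables (D : hopf_data V) (E : hopf_data W) (f : V -> W).
Hypotheses (hE : is_hopf_algebra E) (mf : is_hopf_morphism D E f).

Let lf := hmorph_linear mf.
Let fM := hmorph_mul mf.
Let f1 := hmorph_one mf.
Let fe := hmorph_counit mf.
Let fS := hmorph_antipode mf.

Lemma tlift_hmorph_comul (U : lmodType k) (F : W -> W -> U) (h : V) :
  bilinear_for *:%R *:%R F ->
  tlift F (hcomul E (f h)) = \tsum_(h1 ⊗ h2 <- hcomul D h) F (f h1) (f h2).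
Proof. by move=> bF; rewrite (hmorph_comul mf) tlift_tens_map. Qed.

Hypothesis bf : bijective f.

Let fI : injective f := bij_inj bf.

(** The second factor [u] is left general so that the result can be iterated: [u = f] gives [ff],
    and [u = tens_map f f] gives [fff], the map in which coassociativity is tested. *)
Let tens_map_inj (U U' : lmodType k) (u : U -> U') : linear u ->
  bijective u -> linear (tens_map f u) /\ bijective (tens_map f u).
Proof.
move=> lu [u' uK u'K]; have [g fK gK] := bf; split.
  exact: tens_map_linear.
have lg := can_linear lf fK gK.
have lu' := can_linear lu uK u'K.
by exists (tens_map g u'); apply: tens_mapK.
Qed.

Let ff := tens_map_inj lf bf.
Let fff := tens_map_inj ff.1 ff.2.
Let ffI : injective (tens_map f f) := bij_inj ff.2.
Let fffI : injective (tens_map f (tens_map f f)) := bij_inj fff.2.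

Let fffE x y z :
  tens_map f (tens_map f f) (x ⊗ (y ⊗ z)) = f x ⊗ (f y ⊗ f z).
Proof. rewrite tens_mapE; [by rewrite tens_mapE | exact: lf | exact: ff.1]. Qed.

Lemma is_algebra_transport : is_algebra D.
Proof.
have aE := hopf_algebraP hE; have [bl br] := hmul_bilinear aE.
split=> [|x y z|x|x].
- split=> [z c x y|z c x y]; apply: fI.
  + by rewrite fM !lf bl !fM.
  + by rewrite fM !lf br !fM.
- by apply: fI; rewrite !fM (hmulA aE).
- by apply: fI; rewrite fM f1 (hmul1l aE).
- by apply: fI; rewrite fM f1 (hmul1r aE).
Qed.

Lemma is_coalgebra_transport : is_coalgebra D.
Proof.
have cE := hopf_coalgebraP hE.
split=> [c x y|c x y|h|h|h].
- by apply: ffI; rewrite ff.1 -!(hmorph_comul mf) lf (hcomul_linear cE).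
- by rewrite -!fe lf (hcounit_linear cE).
- apply: fffI; rewrite !(linear_tlift _ _ fff.1).
  (* The images of both sides under [fff] are the two sides of coassociativity of [E] at [f h]. *)
  transitivity (\tsum_(h1 ⊗ h2 <- hcomul E (f h))
      \tsum_(h11 ⊗ h12 <- hcomul E h1) (h11 ⊗ (h12 ⊗ h2))).
    rewrite (tlift_hmorph_comul _ (coassocl_bilinear hE)).
    apply: eq_tlift => h1 h2; rewrite (linear_tlift _ _ fff.1).
    rewrite tlift_hmorph_comul; last exact: tens3l_bilinear.
    by apply: eq_tlift => x y; apply: fffE.
  rewrite (hcomulA cE) (tlift_hmorph_comul _ (coassocr_bilinear hE)).
  apply: eq_tlift => h1 h2; rewrite (linear_tlift _ _ fff.1).
  rewrite tlift_hmorph_comul; last exact: tens3r_bilinear.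
  by apply: eq_tlift => x y; rewrite fffE.
- apply: fI; rewrite (linear_tlift _ _ lf) -[RHS](hcounitl cE).
  rewrite (tlift_hmorph_comul _ (counitl_bilinear hE)).
  by apply: eq_tlift => x y; rewrite fe (linearZ_fun _ _ lf).
- apply: fI; rewrite (linear_tlift _ _ lf) -[RHS](hcounitr cE).
  rewrite (tlift_hmorph_comul _ (counitr_bilinear hE)).
  by apply: eq_tlift => x y; rewrite fe (linearZ_fun _ _ lf).
Qed.

(** Identities in [V] are tested after the injective [f], those in the tensor square after
    [tens_map f f]; each then becomes the same axiom of [E] at images under [f]. *)
Lemma is_hopf_algebra_transport : is_hopf_algebra D.
Proof.
split; [exact: is_algebra_transport | exact: is_coalgebra_transport | ..].
- by apply: ffI; rewrite -(hmorph_comul mf) tens_mapE // f1 (hcomul1 hE).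
- move=> g h; apply: ffI; rewrite -(hmorph_comul mf) fM (hcomulM hE).
  rewrite (tlift_hmorph_comul _ (tens_mul_bilinear hE _)).
  rewrite (linear_tlift _ _ ff.1); apply: eq_tlift => g1 g2.
  rewrite (tlift_hmorph_comul _ (mul_tens_bilinear hE _ _)).
  rewrite (linear_tlift _ _ ff.1); apply: eq_tlift => h1 h2.
  by rewrite tens_mapE // !fM.
- by rewrite -fe f1 (hcounit1 hE).
- by move=> x y; rewrite -!fe fM (hcounitM hE).
- by move=> c x y; apply: fI; rewrite fS !lf (hantipode_linear hE) !fS.
- move=> h; apply: fI; rewrite (linear_tlift _ _ lf) (linearZ_fun _ _ lf) f1 -fe.
  rewrite -(hantipodel hE) (tlift_hmorph_comul _ (antipodel_bilinear hE)).
  by apply: eq_tlift => x y; rewrite fM fS.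
- move=> h; apply: fI; rewrite (linear_tlift _ _ lf) (linearZ_fun _ _ lf) f1 -fe.
  rewrite -(hantipoder hE) (tlift_hmorph_comul _ (antipoder_bilinear hE)).
  by apply: eq_tlift => x y; rewrite fM fS.
Qed.

End Transport.

(** * The multiplication map intertwines the operations *)

Section SmashMultiplication.
Variables (k : fieldType) (H : hopfAlgType k).

Let hH := hopf_data_ofP H.
Let cH := hopf_coalgebraP hH.
Let antL : linear (antipode : H -> H) := hantipode_linear hH.
Let comL : linear (comul : H -> tensor H H) := hcomul_linear cH.
Let mulrL (x : H) : linear ( *%R^~ x) :=
  (hmul_bilinear (hopf_algebraP hH)).1 x.
Let mullL (x : H) : linear ( *%R x) :=
  (hmul_bilinear (hopf_algebraP hH)).2 x.

Lemma adjoint_bilinear (x a : H) :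
  bilinear_for *:%R *:%R (fun y z : H => x * a * antipode y * z).
Proof.
split=> [z c y y'|y c z z'] /=.
- by rewrite antL mulrDr mulrDl -scalerAr -scalerAl.
- by rewrite mulrDr -scalerAr.
Qed.

(** Makes the trilinear expression [x * a * antipode y * z] a linear map on the space [H ⊗ (H ⊗ H)],
    where coassociativity is stated. *)
Lemma adjoint_trilinear (a : H) :
  bilinear_for *:%R *:%R (fun (x : H) (t : tensor H H) =>
    \tsum_(y ⊗ z <- t) (x * a * antipode y * z)).
Proof.
split=> [t|x]; last exact/tlift_linear/adjoint_bilinear.
apply: tlift_param_linear => y z c x x'.
by rewrite !mulrDl -!scalerAl.
Qed.

(** Coassociativity regroups [h_1 a S(h_2) h_3] so that [S(h_2) h_3] collapses to a counit, which is
    then absorbed into [h_1]. *)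
Lemma adjoint_mulr (h a : H) :
  \tsum_(h1 ⊗ h2 <- comul h)
    ((\tsum_(h11 ⊗ h12 <- comul h1) (h11 * a * antipode h12)) * h2) = h * a.
Proof.
have bT := adjoint_trilinear a; have lT := tlift_linear bT.
(* The left side is the trilinear map applied to the left-bracketed double coproduct, ready for
   [hcomulA]. *)
transitivity (tlift (fun x t => \tsum_(y ⊗ z <- t) (x * a * antipode y * z))
    (\tsum_(h1 ⊗ h2 <- comul h)
      \tsum_(h11 ⊗ h12 <- comul h1) (h11 ⊗ (h12 ⊗ h2)))).
  rewrite (linear_tlift _ _ lT); apply: eq_tlift => h1 h2.
  rewrite (linear_tlift _ _ lT) (linear_tlift _ _ (mulrL h2)).
  apply: eq_tlift => x y; rewrite (tliftE _ _ bT) tliftE //.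
  exact: adjoint_bilinear.
rewrite (hcomulA cH) (linear_tlift _ _ lT).
transitivity (\tsum_(h1 ⊗ h2 <- comul h) (counit h2 *: h1 * a)).
  apply: eq_tlift => h1 h2; rewrite (linear_tlift _ _ lT).
  transitivity (h1 * a * \tsum_(x ⊗ y <- comul h2) (antipode x * y)).
    rewrite (linear_tlift _ _ (mullL _)); apply: eq_tlift => x y.
    rewrite (tliftE _ _ bT) tliftE ?mulrA //; exact: adjoint_bilinear.
  by rewrite (hantipodel hH h2) /= -scalerAr mulr1 scalerAl.
by rewrite -(linear_tlift _ _ (mulrL a)) (hcounitr cH h).
Qed.

Lemma val_mul_bilinear (A L : subalgClosed H) :
  bilinear_for *:%R *:%R
    (fun (a : subalg_of A) (l : subalg_of L) => val a * val l).
Proof.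
split=> [l c a a'|a c l l'] /=.
- exact: mulrL.
- exact: mullL.
Qed.

Lemma mul_map_linear (A L : subalgClosed H) : linear (mul_map A L).
Proof. exact/tlift_linear/val_mul_bilinear. Qed.

Lemma mul_mapE (A L : subalgClosed H) a l :
  mul_map A L (a ⊗ l) = val a * val l.
Proof. exact/tliftE/val_mul_bilinear. Qed.

(** [sub_comul] is a chosen preimage, and its defining property suffices to move sums over it into
    [H]. *)
Lemma tlift_sub_comul (U : lmodType k) (A : subalgClosed H)
    (hA : is_hopf_subalgebra A) (F : H -> H -> U) a :
  bilinear_for *:%R *:%R F ->
  \tsum_(a1 ⊗ a2 <- sub_comul hA a) F (val a1) (val a2) =
  tlift F (comul (val a)).
Proof. by move=> bF; rewrite -(svalP (cid (comul_closed hA a))) tlift_tens_map. Qed.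

Variables (A L : subalgClosed H).
Hypotheses (hA : is_hopf_subalgebra A) (hL : is_hopf_subalgebra L).
Hypothesis (nA : is_normal A).

Let phi := mul_map A L.
Let lphi : linear phi := @mul_map_linear A L.

Lemma mul_map_smash_mul x y :
  phi (smash_mul hL nA x y) = phi x * phi y.
Proof.
(* Expanding [x], and then [y], over representatives reduces the claim to pure tensors. *)
rewrite {2}/phi /mul_map (linear_tlift _ _ (mulrL _)) (linear_tlift _ _ lphi).
apply: eq_tlift => a l.
rewrite {2}/phi /mul_map (linear_tlift _ _ (mullL _)) (linear_tlift _ _ lphi).
apply: eq_tlift => a' l'; rewrite (linear_tlift _ _ lphi).
(* [F] extends [(l_1 . a') l_2] from [L] to all of [H], so that the sum over [sub_comul] becomes one
   over [comul], to which [adjoint_mulr] applies. *)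
pose F (l1 l2 : H) :=
  (\tsum_(l11 ⊗ l12 <- comul l1) (l11 * val a' * antipode l12)) * l2.
have bF : bilinear_for *:%R *:%R F.
  split=> [w c u v|w c u v]; last exact: mullL.
  rewrite /F comL tlift_linear ?mulrL //.
  split=> [w' d u' v'|w' d u' v'].
  - by rewrite !mulrDl -!scalerAl.
  - by rewrite antL mulrDr -scalerAr.
transitivity (val a * ((\tsum_(l1 ⊗ l2 <- comul (val l)) F l1 l2) * val l')).
  rewrite -(tlift_sub_comul hL _ bF).
  rewrite (linear_tlift _ _ (mulrL _)) (linear_tlift _ _ (mullL _)).
  by apply: eq_tlift => l1 l2; rewrite /phi mul_mapE !rmorphM /= /F !mulrA.
by rewrite adjoint_mulr !mulrA.
Qed.

(** On pure tensors both sides are [a_1 l_1 ⊗ a_2 l_2]: the middle flip in [smash_comul] matches the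
    componentwise product in [hcomulM]. *)
Lemma comul_mul_map x :
  comul (phi x) = tens_map phi phi (smash_comul hA hL x).
Proof.
have lpp := tens_map_linear lphi lphi.
rewrite {1}/phi /mul_map (linear_tlift _ _ comL).
rewrite (linear_tlift _ _ lpp); apply: eq_tlift => a l.
rewrite [LHS](hcomulM hH) (linear_tlift _ _ lpp).
rewrite -(tlift_sub_comul hA _ (tens_mul_bilinear hH _)).
apply: eq_tlift => a1 a2; rewrite (linear_tlift _ _ lpp).
rewrite -(tlift_sub_comul hL _ (mul_tens_bilinear hH _ _)).
by apply: eq_tlift => l1 l2; rewrite tens_mapE // /phi !mul_mapE.
Qed.

Lemma counit_mul_map x : counit (phi x) = smash_counit x.
Proof.
(* [k^o] is [k] as a module over itself, which makes the counit a linear map between modules. *)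
rewrite [LHS](linear_tlift (U' := k^o) _ _ (hcounit_linear cH)).
by apply: (eq_tlift (U := k^o)) => a l; apply: (hcounitM hH).
Qed.

End SmashMultiplication.

Unset Implicit Arguments.

Theorem proposition2p5 (k : closedFieldType) (k_char0 : [pchar k] =i pred0)
    (H : hopfAlgType k) (A L : subalgClosed H)
    (hA : is_hopf_subalgebra A) (hL : is_hopf_subalgebra L)
    (AL_fact : is_factorization A L) (nA : is_normal A) :
  exists S : tensor (subalg_of A) (subalg_of L) ->
             tensor (subalg_of A) (subalg_of L),
    is_hopf_algebra (smash_data hA hL nA S) /\
    is_hopf_isomorphism (smash_data hA hL nA S) (hopf_data_of H) (mul_map A L).
Proof.
have [psi phiK psiK] := AL_fact.
exists (psi \o antipode \o mul_map A L).
set D := smash_data _ _ _ _.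
have mphi : is_hopf_morphism D (hopf_data_of H) (mul_map A L).
  split=> [|x y||x|x|x] /=.
  - exact: mul_map_linear.
  - exact: mul_map_smash_mul.
  - by rewrite mul_mapE !rmorph1 mulr1.
  - exact: comul_mul_map.
  - exact: counit_mul_map.
  (* The antipode was chosen as a conjugate of that of [H], so only [phi (psi z) = z] remains. *)
  - by rewrite psiK.
split; last by split.
exact: is_hopf_algebra_transport (hopf_data_ofP H) mphi AL_fact.
Qed.
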